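(* Let $(S,d)$ be a complete separable metric space and let $M\subset\mathcal{M}(S)$ be such that $m:=\sup_{\mu\in M}\|\mu\|_{\mathrm{TV}}<\infty$. If the restriction of the $\sigma(\mathcal{M}(S),\mathrm{BL}(S))$-weak topology to $M$ is first countable, then this topology coincides with the restriction of the $\|\cdot\|_{\mathrm{BL}}^*$-norm topology to $M$.
   Context: $\mathcal{M}(S)$ is the space of finite signed Borel measures on $S$ and $\langle\mu,f\rangle:=\int_S f\,d\mu$. $\mathrm{BL}(S)$ is the space of bounded real-valued Lipschitz functions on $(S,d)$ with norm $\|f\|_{\mathrm{BL}}:=\|f\|_\infty+|f|_L$, where $|f|_L:=\sup\{|f(x)-f(y)|/d(x,y):x\neq y\}$. The $\sigma(\mathcal{M}(S),\mathrm{BL}(S))$-weak topology is the coarsest topology on $\mathcal{M}(S)$ making $\mu\mapsto\langle\mu,f\rangle$ continuous for every $f\in\mathrm{BL}(S)$. The dual bounded Lipschitz norm is $\|\mu\|_{\mathrm{BL}}^*:=\sup\{|\langle\mu,f\rangle|:f\in\mathrm{BL}(S),\ \|f\|_{\mathrm{BL}}\le1\}$, and $\|\mu\|_{\mathrm{TV}}:=|\mu|(S)$ is the total variation norm. *)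

(* Defs.v *)
From HB Require Import structures.
From mathcomp Require Import all_boot all_order all_algebra.
From mathcomp Require Import all_classical all_reals all_analysis.

Set Implicit Arguments.
Unset Strict Implicit.
Unset Printing Implicit Defensive.

Import Order.TTheory GRing.Theory Num.Theory.
Import numFieldNormedType.Exports.

Local Open Scope classical_set_scope.
Local Open Scope ring_scope.

#[short(type="completeMetricType")]
HB.structure Definition CompleteMetric (R : realType) :=
  {T of Metric R T & CompletePseudoMetric R T}.

Definition separable (T : topologicalType) :=
  exists2 D : set T, countable D & dense D.

Definition first_countable (T : topologicalType) :=
  forall x : T, exists B : set (set T),
    [/\ countable B, B `<=` nbhs x & filter_from B id --> x].

Section signed_measures.
Context {R : realType} (S : completeMetricType R).

Definition borel : Type := g_sigma_algebraType (@open S).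
HB.instance Definition _ := Measurable.on borel.

(* Charges are functions on all subsets of S. Two charges that agree on the
   Borel sets are the same signed measure: they are not separated by the
   pairing below, hence by neither of the two topologies. *)
Definition signed_measure : Type := {charge set borel -> \bar R}.
HB.instance Definition _ := gen_eqMixin signed_measure.
HB.instance Definition _ := gen_choiceMixin signed_measure.

(* The choice of the Hahn sets is immaterial by Hahn_decomposition_uniq. *)
Definition hahn_pos (mu : signed_measure) : set borel :=
  sval (cid (Hahn_decomposition mu)).

Definition hahn_neg (mu : signed_measure) : set borel :=
  sval (cid (svalP (cid (Hahn_decomposition mu)))).

Lemma hahnP (mu : signed_measure) :
  hahn_decomposition mu (hahn_pos mu) (hahn_neg mu).
Proof. exact: svalP (cid (svalP (cid (Hahn_decomposition mu)))). Qed.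

Definition tv_norm (mu : signed_measure) : \bar R :=
  charge_variation (hahnP mu) [set: borel].

Definition pairing (mu : signed_measure) (f : S -> R) : R :=
  \int[jordan_pos (hahnP mu)]_x f x - \int[jordan_neg (hahnP mu)]_x f x.

Definition BL : set (S -> R) :=
  [set f | bounded_fun f /\
    exists k : R, forall x y : S, `|f x - f y| <= k * mdist x y].

Definition sup_norm (f : S -> R) : R := sup [set `|f x| | x in [set: S]].

(* On a one-point space the set of quotients is empty and its sup is 0. *)
Definition lip_seminorm (f : S -> R) : R :=
  sup [set `|f xy.1 - f xy.2| / mdist xy.1 xy.2 | xy in [set xy | xy.1 != xy.2]].

Definition BL_norm (f : S -> R) : R := sup_norm f + lip_seminorm f.

Definition BL_dual_norm (mu : signed_measure) : R :=
  sup [set `|pairing mu f| | f in [set f | BL f /\ BL_norm f <= 1]].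

Definition msub (mu nu : signed_measure) : signed_measure := cadd mu (copp nu).

Definition weak_measures : Type :=
  sup_topology (fun f : BL => Topological.on
    (initial_topology (fun mu : signed_measure => pairing mu (set_val f)))).
HB.instance Definition _ := Topological.on weak_measures.

Definition normed_measures : Type := signed_measure.
HB.instance Definition _ := Choice.on normed_measures.

Definition norm_open : set_system normed_measures :=
  [set U | forall mu, U mu -> exists2 e : R, 0 < e &
    forall nu, BL_dual_norm (msub nu mu) < e -> U nu].

Let norm_openT : norm_open [set: normed_measures].
Proof. by move=> mu _; exists 1. Qed.

Let norm_openI : setI_closed norm_open.
Proof.
move=> A B oA oB mu [/oA[e e0 eA] /oB[r r0 rB]].
exists (Num.min e r); first by rewrite lt_min e0.
by move=> nu; rewrite lt_min => /andP[/eA ? /rB].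
Qed.

Let norm_open_bigcup (I : Type) (F : I -> set normed_measures) :
  (forall i, norm_open (F i)) -> norm_open (\bigcup_i F i).
Proof.
move=> oF mu [i _ /(oF i)[e e0 eF]]; exists e => // nu /eF Fnu.
by exists i.
Qed.

HB.instance Definition _ := isOpenTopological.Build normed_measures
  norm_openT norm_openI norm_open_bigcup.

Definition weak_subspace (M : set signed_measure) : topologicalType :=
  set_type (M : set weak_measures).

Definition norm_subspace (M : set signed_measure) : topologicalType :=
  set_type (M : set normed_measures).

End signed_measures.

(* Main.v *)
Require Import Defs.
From HB Require Import structures.
From mathcomp Require Import all_boot all_order all_algebra.
From mathcomp Require Import all_classical all_reals all_analysis.
From mathcomp Require Import ring lra.

Set Implicit Arguments.
Unset Strict Implicit.
Unset Printing Implicit Defensive.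

Import Order.TTheory GRing.Theory Num.Theory.
Import numFieldNormedType.Exports.

Local Open Scope classical_set_scope.
Local Open Scope ring_scope.

(** One inclusion is soft: [mu |-> pairing mu f] is Lipschitz for the dual norm,
with constant at most [BL_norm f + 1] ([pairing_le_dual_norm]), so weakly open
sets are norm open.

For the other one, first countability reduces the question to sequences: if a
norm open set [U] of [M] were not a weak neighbourhood of one of its points
[mu], some sequence of [M] outside [U] would converge weakly to [mu]
([first_countable_sequence]). It remains to see that on sets of bounded total
variation a weakly convergent sequence converges for the dual norm, a property
of Schur type ([schur], [weak_cvg_dual_norm]).

Let [L_n] be a sequence of signed measures, bounded in total variation and
converging weakly to 0, and suppose that [e < `|L_n f_n|] for infinitely many
[n], with [f_n] bounded by 1 and 1-Lipschitz. Two facts drive a gliding hump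
argument at a fixed small scale [d].
- The [L_n] become uniformly small, up to [3 d] times the total variation, on
  the functions [f_n] cut off around a fixed finite set [F] of points: such a
  function is within [3 d] of a combination of finitely many fixed Lipschitz
  functions with coefficients [f_n p], [p] in [F] ([interp_approx],
  [cutoff_small]).
- By separability, each single [L_n] is carried, up to a small error, by the
  [d]-neighbourhood of a finite set ([finite_measure_tight]).
Hence a finite set [F] and an index being given, [f_n] for a later [n] can be
cut off away from [F] and close to a larger finite set [F'], with a result [g]
such that [`|L_n g|] is still more than [5 e / 8] ([next_hump]). Iterating gives
functions [g_k] with disjoint supports and a common Lipschitz constant. Because
the supports are disjoint, the sum of all the [g_k] is again bounded and
Lipschitz ([disjoint_sum]), and along the chosen subsequence [L_n] takes on it
values of modulus more than [3 e / 8]: the earlier humps contribute little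
because [n] is large, the later ones because they avoid the neighbourhood that
carries [L_n]. This contradicts weak convergence. *)

(** * Lipschitz functions and cutoffs around finite sets *)

Section lipschitz.
Context {R : realType} {S : completeMetricType R}.
Implicit Types (f g : S -> R) (a b k l : R).

Definition lip k f := forall x y, `|f x - f y| <= k * mdist x y.

Lemma lipD k l f g : lip k f -> lip l g -> lip (k + l) (fun x => f x + g x).
Proof.
move=> fk gl x y; rewrite opprD addrACA mulrDl.
exact: le_trans (ler_normD _ _) (lerD (fk x y) (gl x y)).
Qed.

Lemma lipZ a k f : lip k f -> lip (`|a| * k) (fun x => a * f x).
Proof. by move=> fk x y; rewrite -mulrBr normrM -mulrA ler_wpM2l. Qed.

Lemma lipM a b k l f g : (forall x, `|f x| <= a) -> (forall x, `|g x| <= b) ->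
  lip k f -> lip l g -> lip (k * b + a * l) (fun x => f x * g x).
Proof.
move=> fa gb fk gl x y.
have -> : f x * g x - f y * g y = (f x - f y) * g x + f y * (g x - g y).
  by ring.
rewrite (le_trans (ler_normD _ _))// !normrM mulrDl lerD//.
  by rewrite mulrAC ler_pM.
by rewrite -mulrA ler_pM.
Qed.

Lemma BLP f : BL f <-> exists c k,
  [/\ 0 <= c, (forall x, `|f x| <= c) & lip k f].
Proof.
split=> [[[c [creal fc]] [k fk]]|[c [k [c0 fc fk]]]].
  exists (`|c| + 1), k; split => // x.
  by apply: fc => //; rewrite ltr_pwDr// ler_norm.
split; last by exists k.
exists c; split; first exact: num_real.
by move=> z cz x _; exact: le_trans (fc x) (ltW cz).
Qed.

Lemma BL_lin a f g : BL f -> BL g -> BL (fun x => a * f x + g x).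
Proof.
move=> /BLP[c [k [c0 fc fk]]] /BLP[d [l [d0 gd gl]]]; apply/BLP.
exists (`|a| * c + d), (`|a| * k + l); split; first by rewrite addr_ge0 ?mulr_ge0.
  by move=> x; rewrite (le_trans (ler_normD _ _))// lerD// normrM ler_wpM2l.
exact: lipD (lipZ a fk) gl.
Qed.

Lemma BL0 : BL (fun _ : S => 0 : R).
Proof.
by apply/BLP; exists 0, 0; split=> // [x|x y]; rewrite ?subrr normr0 ?mul0r.
Qed.

Lemma BLB f g : BL f -> BL g -> BL (fun x => f x - g x).
Proof.
move=> Bf Bg; have := BL_lin (-1) Bg Bf.
by congr BL; apply/funext => x; rewrite mulN1r addrC.
Qed.

Lemma BL_unit k f : (forall x, `|f x| <= 1) -> lip k f -> BL f.
Proof. by move=> f1 fk; apply/BLP; exists 1, k. Qed.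

Definition clamp (t : R) : R := Num.min 1 (Num.max 0 t).

Lemma clamp_itv t : 0 <= clamp t <= 1.
Proof.
by rewrite /clamp le_min ler01 le_max lexx ge_min lexx.
Qed.

Lemma clamp_lip s t : `|clamp s - clamp t| <= `|s - t|.
Proof.
rewrite /clamp ler_norml; have := ler_norm (s - t); have := ler_norm (t - s).
rewrite (distrC t s).
have min10 : Num.min 1 0 = 0 :> R by rewrite min_r.
case: (lerP 0 s) => ?; case: (lerP 0 t) => ?; rewrite ?min10;
  rewrite /Num.min; repeat case: ifPn; rewrite -?leNgt => *;
  apply/andP; split; lra.
Qed.

Lemma clamp_eq1 t : 1 <= t -> clamp t = 1.
Proof. by rewrite /clamp => ?; rewrite max_r ?min_l//; lra. Qed.

Lemma clamp_gt0 t : 0 < clamp t -> 0 < t.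
Proof. by rewrite /clamp lt_min lt_max ltxx => /andP[]. Qed.

Section cutoff.
Variables (d : R) (d0 : 0 < d).
Implicit Types (r : R) (F : seq S).

(** A Lipschitz substitute for the indicator of a neighbourhood of [F]: it is 1
within distance [r] of [F] and 0 beyond [r + d]. A maximum over [F] keeps the
Lipschitz constant [d^-1] whatever the size of [F]. *)
Definition cutoff r F (y : S) : R :=
  foldr (fun p m => Num.max (clamp ((r + d - mdist p y) / d)) m) 0 F.

Lemma cutoff_itv r F y : 0 <= cutoff r F y <= 1.
Proof.
elim: F => [|p F /andP[F0 F1]] /=; first by rewrite lexx ler01.
rewrite le_max F0 orbT ge_max F1 andbT /=.
by case/andP: (clamp_itv ((r + d - mdist p y) / d)).
Qed.

Lemma norm_cutoff_le1 r F y : `|cutoff r F y| <= 1.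
Proof. by rewrite ger0_norm; case/andP: (cutoff_itv r F y). Qed.

Lemma norm_cutoffC_le1 r F y : `|1 - cutoff r F y| <= 1.
Proof. by case/andP: (cutoff_itv r F y) => ? ?; rewrite ger0_norm; lra. Qed.

Lemma cutoff_lip r F : lip d^-1 (cutoff r F).
Proof.
have dV0 : 0 <= d^-1 by rewrite invr_ge0 ltW.
move=> y z; elim: F => [|p F IH] /=.
  by rewrite subrr normr0 mulr_ge0 ?mdist_ge0.
set a := clamp _; set b := clamp _.
have ab : `|a - b| <= d^-1 * mdist y z.
  rewrite (le_trans (clamp_lip _ _))// -mulrBl normrM [leLHS]mulrC.
  rewrite ger0_norm// ler_wpM2l//.
  have := metric_triangle p y z; have := metric_triangle p z y.
  rewrite (metric_sym z y) ler_norml; lra.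
move: ab IH; rewrite !ler_norml => /andP[? ?] /andP[? ?].
by case: (lerP a) => ?; case: (lerP b) => ?; lra.
Qed.

Lemma cutoff_BL r F : BL (cutoff r F).
Proof. exact: BL_unit (norm_cutoff_le1 r F) (cutoff_lip r F). Qed.

Lemma cutoffC_lip r F : lip d^-1 (fun y => 1 - cutoff r F y).
Proof.
move=> y z; have -> : 1 - cutoff r F y - (1 - cutoff r F z) =
  cutoff r F z - cutoff r F y by ring.
by rewrite distrC; exact: cutoff_lip.
Qed.

Lemma cutoff_eq1 r F p y : p \in F -> mdist p y <= r -> cutoff r F y = 1.
Proof.
move=> pF py; apply/eqP; rewrite eq_le; case/andP: (cutoff_itv r F y) => _ -> /=.
elim: F pF => //= q F IH; rewrite inE => /predU1P[<-|/IH F1]; rewrite le_max.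
  by rewrite clamp_eq1 ?lexx// ler_pdivlMr// mul1r; lra.
by rewrite F1 orbT.
Qed.

Lemma bump_neq0 r (p y : S) : clamp ((r + d - mdist p y) / d) != 0 ->
  mdist p y < r + d.
Proof.
move=> c0; have : 0 < clamp ((r + d - mdist p y) / d).
  by rewrite lt_def c0; case/andP: (clamp_itv ((r + d - mdist p y) / d)).
by move/clamp_gt0; rewrite pmulr_lgt0 ?invr_gt0// subr_gt0.
Qed.

Lemma cutoff_neq0 r F y : cutoff r F y != 0 ->
  exists2 p, p \in F & mdist p y < r + d.
Proof.
elim: F => [|p F IH] /=; first by rewrite eqxx.
have [_ /IH[q qF qy]|_ /bump_neq0 py] := leP.
  by exists q => //; rewrite inE qF orbT.
by exists p => //; rewrite mem_head.
Qed.

(** The increments of [cutoff] along the list [F] are nonnegative, add up to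
[cutoff r F], and the one at [p] is supported near [p]: they are a partition
of [cutoff r F], with which [f] is interpolated from its values on [F]. *)
Fixpoint interp r F (f : S -> R) (y : S) : R :=
  if F is p :: F' then
    f p * (cutoff r (p :: F') y - cutoff r F' y) + interp r F' f y
  else 0.

(** On the support of the increment at [p], the values of a 1-Lipschitz [f] differ
from [f p] by at most [r + d]. *)
Lemma interp_approx r F f : lip 1 f ->
  forall y, `|cutoff r F y * f y - interp r F f y| <= (r + d) * cutoff r F y.
Proof.
move=> f1 y; elim: F => [|p F IH]; first by rewrite /= mul0r subr0 normr0 mulr0.
rewrite [interp _ _ _ _]/=.
set c := cutoff r (p :: F) y; set c' := cutoff r F y in IH *.
have c'c : c' <= c by rewrite /c /= le_max lexx orbT.
have -> : c * f y - (f p * (c - c') + interp r F f y) =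
  (c - c') * (f y - f p) + (c' * f y - interp r F f y) by ring.
have -> : (r + d) * c = (r + d) * (c - c') + (r + d) * c' by ring.
rewrite (le_trans (ler_normD _ _))// lerD// normrM ger0_norm ?subr_ge0// mulrC.
have [->|cc'] := eqVneq c c'; first by rewrite subrr !mulr0.
rewrite ler_wpM2r ?subr_ge0// distrC (le_trans (f1 p y))// mul1r ltW//.
apply: bump_neq0; apply: contra cc' => /eqP b0.
rewrite /c /= b0 max_r//; first by case/andP: (cutoff_itv r F y).
Qed.

Lemma interp_BL r F f : BL (interp r F f).
Proof.
elim: F => [|p F IH]; first exact: BL0.
by apply: BL_lin IH; apply: BLB; exact: cutoff_BL.
Qed.

End cutoff.
End lipschitz.

(** * The Schur property for tight functionals *)

Section functionals.
Context {R : realType} {S : completeMetricType R}.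
Implicit Types (T a c d e l r : R) (L : (S -> R) -> R) (f g : S -> R).

(** The properties of a finite signed measure, seen as a functional on [BL], that
the Schur property rests on. [T] plays the role of the total variation; the
last clause says that all but [e] of the mass lies within [r] of a finite set,
which replaces tightness with respect to compact sets. *)
Definition tight_functional T L :=
  [/\ forall a f g, BL f -> BL g ->
        L (fun x => a * f x + g x) = a * L f + L g,
      forall c f, 0 <= c -> BL f -> (forall x, `|f x| <= c) -> `|L f| <= c * T
    & forall r e, 0 < r -> 0 < e -> exists F : seq S, forall f,
        BL f -> (forall x, `|f x| <= 1) ->
        (forall x p, p \in F -> mdist p x <= r -> f x = 0) -> `|L f| <= e].

Lemma tight_functional_le T1 T2 L : T1 <= T2 ->
  tight_functional T1 L -> tight_functional T2 L.
Proof.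
move=> T12 [lin bnd tight]; split=> // c f c0 Bf fc.
by rewrite (le_trans (bnd c f c0 Bf fc))// ler_wpM2l.
Qed.

Lemma tight_functional0 T L : tight_functional T L -> L (fun=> 0) = 0.
Proof.
move=> [lin _ _]; have -> : (fun=> 0) = (fun _ : S => -1 * 0 + 0 : R).
  by apply/funext => y; rewrite mulr0 addr0.
by rewrite lin ?mulN1r ?addNr//; exact: BL0.
Qed.

Lemma tight_functionalB T1 T2 L1 L2 :
  tight_functional T1 L1 -> tight_functional T2 L2 ->
  tight_functional (T1 + T2) (fun f => L1 f - L2 f).
Proof.
move=> [lin1 bnd1 tight1] [lin2 bnd2 tight2].
split=> [b f g Bf Bg|c f c0 Bf fc|r e r0 e0].
- by rewrite lin1// lin2//; ring.
- by rewrite (le_trans (ler_normB _ _))// mulrDr lerD ?bnd1 ?bnd2.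
have e2 : 0 < e / 2 by rewrite divr_gt0.
have [F1 F1P] := tight1 r (e / 2) r0 e2.
have [F2 F2P] := tight2 r (e / 2) r0 e2.
exists (F1 ++ F2) => f Bf f1 fF; rewrite (le_trans (ler_normB _ _))//.
rewrite [leRHS]splitr.
by rewrite lerD ?F1P ?F2P// => x p pF; apply: fF; rewrite mem_cat pF ?orbT.
Qed.

(** For [x] and [y] in the supports of two distinct functions [g j] and [g k],
the difference of the values of the sum is [g j x - g j y + (g k x - g k y)],
so disjointness of the supports at most doubles the Lipschitz constant, even
though the supports need not be at a positive distance. *)
Lemma disjoint_sum (g : nat -> S -> R) l :
  (forall j m y, g j y != 0 -> g m y != 0 -> j = m) ->
  (forall j y, `|g j y| <= 1) -> (forall j, lip l (g j)) ->
  exists f, [/\ BL f,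
    forall m y, `|f y - \sum_(j < m) g j y| <= 1 &
    forall m y, (forall j, (m <= j)%N -> g j y = 0) -> f y = \sum_(j < m) g j y].
Proof.
(* J y is the only index that can contribute at y. *)
move=> disj g1 gl; pose J y := xget 0%N [set j | g j y != 0].
have gJ j y : j != J y -> g j y = 0.
  apply: contraNeq => gjy; apply/eqP; apply: (disj _ _ y gjy).
  exact: (@xgetPex _ 0%N [set j | g j y != 0] (ex_intro _ j gjy)).
have sumg k y : \sum_(j < k) g j y = if (J y < k)%N then g (J y) y else 0.
  elim: k => [|k IH]; first by rewrite big_ord0.
  rewrite big_ord_recr/= IH ltnS; case: ltngtP => [Jk|kJ|->].
  - by rewrite (gJ k) ?addr0// gtn_eqF.
  - by rewrite (gJ k) ?addr0// ltn_eqF.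
  - by rewrite add0r.
exists (fun y => g (J y) y); split=> [|k y|k y gk].
- apply: (@BL_unit _ _ (l + l)) => [y|y z]; first exact: g1.
  have [JJ|JJ] := eqVneq (J y) (J z).
    rewrite -JJ (le_trans (gl _ _ _))// mulrDl ler_wpDr//.
    exact: le_trans (normr_ge0 _) (gl 0%N y z).
  have -> : g (J y) y - g (J z) z =
      (g (J y) y - g (J y) z) + (g (J z) y - g (J z) z).
    by rewrite (gJ (J y) z)// (gJ (J z) y) 1?eq_sym// subr0 sub0r.
  by rewrite (le_trans (ler_normD _ _))// mulrDl lerD//; exact: gl.
- by rewrite sumg; case: ifP => _; rewrite ?subrr ?subr0 ?normr0 ?ler01 ?g1.
- by rewrite sumg; case: ltnP => // /gk.
Qed.

(** A hump stays far enough from [F] and close enough to [F'] for its support to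
be disjoint from that of a later hump, which stays far from [F']. The constant
[1 + d^-1 + d^-1] is that of a 1-Lipschitz function bounded by 1, multiplied
by two cutoffs. *)
Definition hump d (F F' : seq S) g :=
  [/\ {subset F <= F'}, forall y, `|g y| <= 1, lip (1 + d^-1 + d^-1) g &
    forall y, g y != 0 -> (exists2 p, p \in F' & mdist p y < d + d) /\
      (forall p, p \in F -> d + d < mdist p y)].

Section schur.
Variables (T : R) (L : nat -> (S -> R) -> R).
Hypothesis tightL : forall n, tight_functional T (L n).
Hypothesis cvgL : forall f, BL f -> L n f @[n --> \oo] --> (0 : R).

Let linL n a f g : BL f -> BL g ->
  L n (fun x => a * f x + g x) = a * L n f + L n g.
Proof. by case: (tightL n) => H _ _; exact: H. Qed.

Let L0 n : L n (fun=> 0) = 0.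
Proof. exact: tight_functional0 (tightL n). Qed.

Let near_le (f : S -> R) (e : R) : 0 < e -> BL f -> \forall n \near \oo, `|L n f| <= e.
Proof.
move=> e0 /cvgL /cvgr0Pnorm_le; exact.
Qed.

(** The functionals are small on each of the finitely many increments, and the
coefficients [f p] are bounded by 1, hence the uniformity in [f]. *)
Let interp_small d r F e : 0 < d -> 0 < e -> \forall n \near \oo,
  forall f, (forall x, `|f x| <= 1) -> `|L n (interp d r F f)| <= e.
Proof.
move=> d0; elim: F e => [|p F IH] e e0.
  by apply: nearW => n f _; rewrite /= L0 normr0 ltW.
have e2 : 0 < e / 2 by rewrite divr_gt0.
pose w y := cutoff d r (p :: F) y - cutoff d r F y.
have Bw : BL w by apply: BLB; exact: cutoff_BL.
near=> n => f f1.
have -> : interp d r (p :: F) f = (fun y => f p * w y + interp d r F f y).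
  by [].
rewrite linL//; last exact: interp_BL.
rewrite (le_trans (ler_normD _ _))// [leRHS]splitr lerD//.
  rewrite normrM -[leRHS]mul1r ler_pM//.
  by near: n; exact: near_le.
by move: f f1; near: n; exact: IH.
Unshelve. all: by end_near. Qed.

Let cutoff_small d r F e : 0 < d -> 0 <= r -> 0 < e -> \forall n \near \oo,
  forall f, (forall x, `|f x| <= 1) -> lip 1 f ->
  `|L n (fun x => cutoff d r F x * f x)| <= (r + d) * T + e.
Proof.
move=> d0 r0 e0; have := interp_small r F d0 e0; apply: filterS => n nP f f1 fl.
have Bcf : BL (fun x => cutoff d r F x * f x).
  apply: BL_unit (lipM (norm_cutoff_le1 d r F) f1 (cutoff_lip d0 r F) fl) => x.
  by rewrite normrM mulr_ile1 ?norm_cutoff_le1.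
have BI := interp_BL d0 r F f.
have -> : (fun x => cutoff d r F x * f x) = (fun x => 1 * interp d r F f x +
    (-1 * interp d r F f x + cutoff d r F x * f x)).
  by apply/funext => x; ring.
rewrite linL//; last exact: BL_lin.
rewrite mul1r addrC (le_trans (ler_normD _ _))// lerD ?nP//.
have [_ bnd _] := tightL n; apply: bnd; first by rewrite addr_ge0// ltW.
  exact: BL_lin.
move=> x; rewrite mulN1r addrC (le_trans (interp_approx d0 _ _ fl _))//.
rewrite -[leRHS]mulr1 ler_wpM2l ?addr_ge0 ?(ltW d0)//.
by case/andP: (cutoff_itv d r F x).
Qed.

(** One step of the gliding hump. The function [f] given by the failure of uniform
smallness loses at most [2 (e / 8)] when its part near [F] is removed, by
[cutoff_small], and at most [e / 8] when its part far from [F'] is removed, by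
tightness of [L n]. *)
Let next_hump d e m (F : seq S) G : 0 < e -> 0 < d -> (d + d + d) * T <= e / 8 ->
  (forall m, exists n f, [/\ (m <= n)%N, forall x, `|f x| <= 1, lip 1 f &
    e < `|L n f|]) -> BL G ->
  exists n F' g, [/\ (m <= n)%N, hump d F F' g, `|L n G| <= e / 8,
    5 * (e / 8) < `|L n g| & forall h, BL h -> (forall x, `|h x| <= 1) ->
        (forall x p, p \in F' -> mdist p x <= d -> h x = 0) ->
        `|L n h| <= e / 8].
Proof.
move=> e0 d0 dT bad BG; have e8 : 0 < e / 8 by rewrite divr_gt0.
have dd0 : 0 <= d + d by rewrite addr_ge0// ltW.
have [n1 _ smallG] := near_le e8 BG.
have [n2 _ smallF] := cutoff_small F d0 dd0 e8.
have [n [f [+ f1 fl ef]]] := bad (maxn m (maxn n1 n2)).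
rewrite !geq_max => /and3P[mn n1n n2n].
have [_ _ /(_ _ _ d0 e8)[F0 F0P]] := tightL n.
pose F' := F0 ++ F; pose c := cutoff d (d + d) F; pose c' := cutoff d d F'.
pose fc y := f y * (1 - c y); pose g y := fc y * c' y.
have fc1 y : `|fc y| <= 1 by rewrite normrM mulr_ile1// norm_cutoffC_le1.
have fcl : lip (1 + d^-1) fc.
  have := lipM f1 (norm_cutoffC_le1 d (d + d) F) fl (cutoffC_lip d0 (d + d) F).
  by rewrite mulr1 mul1r.
have g1 y : `|g y| <= 1 by rewrite normrM mulr_ile1// norm_cutoff_le1.
have gl : lip (1 + d^-1 + d^-1) g.
  have := lipM fc1 (norm_cutoff_le1 d d F') fcl (cutoff_lip d0 d F').
  by rewrite mulr1 mul1r.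
have tailF' h : BL h -> (forall x, `|h x| <= 1) ->
    (forall x p, p \in F' -> mdist p x <= d -> h x = 0) -> `|L n h| <= e / 8.
  move=> Bh h1 hF'; apply: F0P => // x p pF0; apply: hF'.
  by rewrite mem_cat pF0.
exists n, F', g; split=> //.
- split=> //; first by move=> p pF; rewrite mem_cat pF orbT.
  move=> y; rewrite /g /fc !mulf_eq0 !negb_or => /andP[/andP[_ c1] c'0].
  split; first exact: cutoff_neq0 c'0.
  move=> p pF; rewrite ltNge; apply: contra c1 => pd.
  by rewrite /c (cutoff_eq1 d0 pF pd) subrr.
- exact: smallG.
- pose h y := fc y * (1 - c' y).
  have h1 y : `|h y| <= 1 by rewrite normrM mulr_ile1// norm_cutoffC_le1.
  have hl := lipM fc1 (norm_cutoffC_le1 d d F') fcl (cutoffC_lip d0 d F').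
  have Bh : BL h := BL_unit h1 hl.
  have Bg : BL g := BL_unit g1 gl.
  have cf1 y : `|c y * f y| <= 1 by rewrite normrM mulr_ile1// norm_cutoff_le1.
  have Bcf : BL (fun y => c y * f y).
    apply: BL_unit cf1 (lipM _ f1 (cutoff_lip d0 (d + d) F) fl).
    exact: norm_cutoff_le1.
  have fE : f = (fun y => 1 * (c y * f y) + (1 * h y + g y)).
    by apply/funext => y; rewrite /h /g /fc; ring.
  have Lcf := smallF _ n2n f f1 fl.
  have Lh : `|L n h| <= e / 8.
    apply: tailF' => // x p pF' px.
    by rewrite /h /c' (cutoff_eq1 d0 pF' px) subrr mulr0.
  have := ef; rewrite {1}fE linL//; last exact: BL_lin.
  rewrite linL// !mul1r.
  move: Lcf Lh; rewrite -/c.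
  move: (L n (fun y => c y * f y)) (L n h) (L n g) => u v w Lcf Lh.
  by have := ler_normD u (v + w); have := ler_normD v w; lra.
Qed.

(** Weak convergence to 0 of uniformly bounded tight functionals is uniform on
the unit ball. Otherwise, humps [g k] for an unbounded sequence of indices
[n k] are built recursively, and the functionals [L (n k)] do not tend to 0 on
the sum of the humps. *)
Lemma schur e : 0 < e -> \forall n \near \oo,
  forall f, (forall x, `|f x| <= 1) -> lip 1 f -> `|L n f| <= e.
Proof.
move=> e0; apply: contrapT => notnear.
have bad m : exists n f,
    [/\ (m <= n)%N, forall x, `|f x| <= 1, lip 1 f & e < `|L n f|].
  apply: contrapT => H; apply: notnear; exists m => // n /= mn f f1 fl.
  by rewrite leNgt; apply/negP => ef; apply: H; exists n, f.
have T0 : 0 <= T.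
  have [_ bnd _] := tightL 0%N; rewrite -[T]mul1r.
  apply: le_trans (normr_ge0 _) (bnd 1 (fun=> 0) ler01 BL0 _) => x.
  by rewrite normr0.
have T1 : 0 < T + 1 by rewrite ltr_wpDl.
(* 24 = 8 * 3: the interpolation error 3 d T has to be at most e / 8. *)
pose d := e / 24 / (T + 1); have d0 : 0 < d by rewrite !divr_gt0.
have dT : (d + d + d) * T <= e / 8.
  have : d * (T + 1) = e / 24 by rewrite /d divfK// gt_eqF.
  by rewrite mulrDr mulr1; lra.
have /choice[next nextP] : forall s : nat * seq S * (S -> R),
    exists t : nat * seq S * (S -> R), BL s.2 ->
    [/\ (s.1.1 <= t.1.1)%N, hump d s.1.2 t.1.2 t.2,
      `|L t.1.1 s.2| <= e / 8,
      5 * (e / 8) < `|L t.1.1 t.2| &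
      forall h, BL h -> (forall x, `|h x| <= 1) ->
        (forall x p, p \in t.1.2 -> mdist p x <= d -> h x = 0) ->
        `|L t.1.1 h| <= e / 8].
  move=> [[m F] G]; have [BG|NBG] := pselect (BL G); last by exists (m, F, G).
  have [n [F' [g nP]]] := next_hump m F e0 d0 dT bad BG.
  by exists (n, F', g).
(* The state holds the step number, the current finite set, and the sum of the
   humps built so far. *)
pose fix st k := if k is k'.+1 then
    let s := st k' in let t := next s in (k, t.1.2, fun y => s.2 y + t.2 y)
  else (0%N, [::], fun=> 0).
pose n k := (next (st k)).1.1; pose F k := (st k).1.2.
pose g k := (next (st k)).2; pose G k := (st k).2.
have st1 k : (st k).1.1 = k by case: k.
have GS k : G k.+1 = (fun y => 1 * G k y + g k y).
  by apply/funext => y; rewrite mul1r.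
have BG k : BL (G k).
  elim: k => [|k IH]; first exact: BL0.
  rewrite GS; apply: BL_lin => //; have [_ [_ g1 gl _] _ _ _] := nextP (st k) IH.
  exact: BL_unit g1 gl.
have GE k y : G k y = \sum_(j < k) g j y.
  elim: k => [|k IH]; first by rewrite big_ord0.
  by rewrite big_ord_recr/= -IH GS mul1r.
have gP k := nextP (st k) (BG k).
have Bg k : BL (g k) by have [_ [_ g1 gl _] _ _ _] := gP k; exact: BL_unit g1 gl.
have F_sub j k : (j <= k)%N -> {subset F j <= F k}.
  move=> /subnK <-; elim: (k - j)%N => // i IH p /IH; rewrite addSn.
  by have [_ [sub _ _ _] _ _ _] := gP (i + j)%N; exact: sub.
have g_far j k y p : (j <= k)%N -> p \in F j -> mdist p y <= d + d -> g k y = 0.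
  move=> jk pFj pd; apply/eqP; apply: contraT => gk0.
  have [_ [_ _ _ /(_ y gk0)[_ far]] _ _ _] := gP k.
  by have := far p (F_sub _ _ jk _ pFj); rewrite ltNge pd.
have disj_lt j k y : (j < k)%N -> g j y != 0 -> g k y = 0.
  move=> jk gj0; have [_ [_ _ _ /(_ y gj0)[[p pF pd] _]] _ _ _] := gP j.
  exact: (g_far j.+1 k y p jk pF (ltW pd)).
have disj j k y : g j y != 0 -> g k y != 0 -> j = k.
  move=> gj gk; case: (ltngtP j k) => // jk.
    by rewrite (disj_lt j k y jk gj) eqxx in gk.
  by rewrite (disj_lt k j y jk gk) eqxx in gj.
have g1 k y : `|g k y| <= 1 by have [_ [_ + _ _] _ _ _] := gP k; exact.
have gl k : lip (1 + d^-1 + d^-1) (g k) by have [_ [_ _ + _] _ _ _] := gP k.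
have [f [Bf f1 fE]] := disjoint_sum disj g1 gl.
have [N _ /(_ (n N))] := near_le (divr_gt0 e0 (ltr0n R 4)) Bf.
have [nN _ LG Lg tail] := gP N; move: nN; rewrite st1 => nN /(_ nN).
(* The humps after the N-th one vanish where L (n N) has most of its mass. *)
pose h y := -1 * G N.+1 y + f y.
have Bh : BL h by exact: BL_lin.
have Lh : `|L (n N) h| <= e / 8.
  apply: tail => // [x|x p pF px].
    by rewrite /h GE mulN1r addrC.
  rewrite /h GE (fE N.+1) ?mulN1r ?addNr// => j Nj.
  by apply: (g_far N.+1 j x p Nj pF); rewrite (le_trans px)// ler_wpDr// ltW.
have fdec : f = (fun y => 1 * G N y + (1 * g N y + h y)).
  by apply/funext => y; rewrite /h GS; ring.
rewrite {1}fdec linL//; last exact: BL_lin.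
rewrite linL// !mul1r.
move: LG Lg Lh; rewrite -/(n N) -/(G N) -/(g N).
move: (L _ _) (L _ _) (L _ _) => u1 u2 u3.
rewrite !ler_norml lter_normr => /andP[? ?] /orP[] ? /andP[? ?] /andP[? ?]; lra.
Qed.

End schur.
End functionals.

(** * Integration against finite signed measures *)

Section measures.
Context {R : realType} {S : completeMetricType R}.
Implicit Types (f : S -> R) (m : {finite_measure set borel S -> \bar R}).

Lemma open_borel (U : set S) : open U -> measurable (U : set (borel S)).
Proof. by move=> oU; exact: sub_sigma_algebra. Qed.

Lemma BL_measurable f : BL f -> measurable_fun [set: borel S] (f : borel S -> R).
Proof.
move=> /BLP[_ [k [_ _ fk]]].
apply: (measurability _ (measurable_realfun.RGenOpens.measurableE R)).
move=> _ [_ [a [b ->] <-]]; rewrite setTI; apply: open_borel.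
have cf : continuous f.
  move=> x; apply/cvgrPdist_lt => e e0; near=> y.
  rewrite (le_lt_trans (fk x y))//.
  have : mdist x y < e / (`|k| + 1).
    suff : ball x (e / (`|k| + 1)) y by rewrite ballEmdist.
    by near: y; apply: nbhsx_ballx; rewrite divr_gt0// ltr_wpDl.
  rewrite ltr_pdivlMr ?ltr_wpDl//; apply: le_lt_trans.
  by rewrite mulrC ler_wpM2l ?mdist_ge0// ler_wpDr// ler_norm.
by move/continuousP : cf; apply; exact: interval_open.
Unshelve. all: by end_near. Qed.

Lemma BL_integrable m f : BL f -> m.-integrable setT (EFin \o (f : borel S -> R)).
Proof.
move=> Bf; apply: measurable_bounded_integrable => //.
- by rewrite ltey_eq fin_num_measure.
- exact: BL_measurable.
- by case: Bf.
Qed.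


(** Finite unions of balls of radius [r] around a dense sequence increase to the
whole space, so the measure of their complements tends to 0. *)
Lemma finite_measure_tight m (r e : R) : separable S -> 0 < r -> 0 < e ->
  exists (F : seq S) (A : set (borel S)),
  [/\ measurable A, forall x, ~ A x -> exists2 p, p \in F & mdist p x <= r &
    (m A <= e%:E)%E].
Proof.
move=> [D cD dD] r0 e0.
have near_dense y : exists2 p, D p & (ball p r)^° y.
  have r2 : 0 < r / 2 by rewrite divr_gt0.
  have [//| |p [yp Dp]] := dD (ball y (r / 2))^°; last 1 first.
  - exists p => //; apply: (@filterS _ _ _ (ball y (r / 2))).
      move=> z yz; rewrite (splitr r); apply: ball_triangle yz.
      by apply: ball_sym; exact: interior_subset yp.
    exact: nbhsx_ballx.
  - by exists y; exact: nbhsx_ballx.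
  - exact: open_interior.
have [D0|[x]] := pfcard_geP cD.
  exists [::], set0; split=> //; last by rewrite measure0 lee_fin ltW.
  by move=> y _; have [p] := near_dense y; rewrite D0.
pose A n := ~` \bigcup_(i in `I_n) (ball (x i) r)^°.
have mA n : measurable (A n : set (borel S)).
  apply: measurableC; apply: bigcup_measurable => i _; apply: open_borel.
  exact: open_interior.
have A0 : \bigcap_n A n = set0.
  rewrite -subset0 => y Ay; have [p Dp py] := near_dense y.
  have [i _ xip] := 'surj_x Dp.
  by apply: (Ay i.+1 I); exists i; rewrite /= ?ltnSn ?xip.
have cvgA : m (A n) @[n --> \oo] --> 0%E.
  rewrite -(measure0 m) -A0; apply: nonincreasing_cvg_mu => //.
  - by rewrite ltey_eq fin_num_measure.
  - by rewrite A0.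
  - move=> i j ij; apply/subsetPset => y Ay [k ki ky].
    by apply: Ay; exists k => //; exact: leq_trans ki ij.
have [|N _ /(_ N (leqnn N)) mN] := cvgA [set z | (z < e%:E)%E].
  by apply: open_ereal_lt'; rewrite lte_fin.
exists [seq x i | i <- iota 0 N], (A N); split=> //; last exact: ltW.
move=> y /contrapT[i iN yi]; exists (x i).
  by apply: map_f; rewrite mem_iota.
by have := interior_subset yi; rewrite ballEmdist => /ltW.
Qed.

Lemma integral_tight m : separable S ->
  tight_functional (fine (m setT)) (fun f => \int[m]_x f x).
Proof.
move=> sepS; split=> [a f g Bf Bg|c f c0 Bf fc|r e r0 e0].
- have If := BL_integrable m Bf; have Ig := BL_integrable m Bg.
  have Iaf : m.-integrable setT (EFin \o (fun x : borel S => a * f x)).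
    exact: (integrableZl measurableT a If).
  by rewrite (RintegralD measurableT Iaf Ig) RintegralZl.
- have If := BL_integrable m Bf.
  rewrite (le_trans (le_normr_Rintegral _ If))// -Rintegral_cst//.
  apply: le_Rintegral => //; first exact: integrable_norm.
  apply: measurable_bounded_integrable => //.
    by rewrite ltey_eq fin_num_measure.
  by exists c; split; [exact: num_real|move=> z cz x _ /=; rewrite ger0_norm// ltW].
have [F [A [mA FA me]]] := finite_measure_tight m sepS r0 e0.
exists F => f Bf f1 fF; have If := BL_integrable m Bf.
rewrite (le_trans (le_normr_Rintegral _ If))//.
have IA : m.-integrable setT (EFin \o \1_A).
  by apply: integrable_indic; rewrite // ltey_eq fin_num_measure.
apply: (@le_trans _ _ (\int[m]_x \1_A x)).
  apply: le_Rintegral => //; first exact: integrable_norm.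
  move=> x _; have [Ax|/FA[p pF px]] := pselect (A x).
    by rewrite indicE mem_set.
  by rewrite (fF x p)// normr0.
rewrite /Rintegral integral_indic// setIT -lee_fin fineK//.
exact: fin_num_measure.
Qed.

End measures.

Section pairing.
Context {R : realType} {S : completeMetricType R}.
Implicit Types (f : S -> R) (mu nu : signed_measure S).

Lemma pairing_tight mu : separable S ->
  tight_functional (fine (tv_norm mu)) (pairing mu).
Proof.
move=> sepS.
have -> : fine (tv_norm mu) = fine (jordan_pos (hahnP mu) setT) +
    fine (jordan_neg (hahnP mu) setT).
  by rewrite -fineD// fin_num_measure.
exact: tight_functionalB (integral_tight _ sepS) (integral_tight _ sepS).
Qed.

Let Rintegral_measure_add (m1 m2 : {measure set borel S -> \bar R}) f :
  (m1 setT < +oo)%E -> (m2 setT < +oo)%E -> BL f ->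
  \int[measure_add m1 m2]_x f x = \int[m1]_x f x + \int[m2]_x f x.
Proof.
move=> m1oo m2oo Bf.
have Im (m : {measure set borel S -> \bar R}) : (m setT < +oo)%E ->
    m.-integrable setT (EFin \o (f : borel S -> R)).
  by move=> moo; apply: measurable_bounded_integrable => //;
    [exact: BL_measurable|case: Bf].
rewrite /Rintegral integral_measure_add//; [|exact: Im..].
by rewrite fineD//; apply: integrable_fin_num => //; exact: Im.
Qed.

(** Moving the negative terms of the balance to the other side makes it an
equality between sums of finite measures, along which integration is additive. *)
Let integral_balance (p n p1 n1 p2 n2 : {finite_measure set borel S -> \bar R}) f :
  BL f -> (forall A, measurable A ->
    p A - n A = (p1 A - n1 A) - (p2 A - n2 A))%E ->
  \int[p]_x f x - \int[n]_x f x =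
  (\int[p1]_x f x - \int[n1]_x f x) - (\int[p2]_x f x - \int[n2]_x f x).
Proof.
move=> Bf bal.
have moo (m : {finite_measure set borel S -> \bar R}) : (m setT < +oo)%E.
  by rewrite ltey_eq fin_num_measure.
have addoo (m1 m2 : {finite_measure set borel S -> \bar R}) :
    (measure_add m1 m2 setT < +oo)%E.
  by rewrite measure_addE lte_add_pinfty//; exact: moo.
have : \int[measure_add (measure_add p n1) p2]_x f x =
    \int[measure_add (measure_add n p1) n2]_x f x.
  congr fine; apply: eq_measure_integral => A mA _.
  have addE (m1 m2 m3 : {finite_measure set borel S -> \bar R}) :
      measure_add (measure_add m1 m2) m3 A = (m1 A + m2 A + m3 A)%E.
    by rewrite measure_addE; congr (_ + _)%E; exact: measure_addE.
  have fineE (m : {finite_measure set borel S -> \bar R}) : m A = (fine (m A))%:E.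
    by rewrite fineK ?fin_num_measure.
  rewrite [LHS]addE [RHS]addE; have := bal A mA.
  rewrite (fineE p) (fineE n) (fineE p1) (fineE n1) (fineE p2) (fineE n2).
  by rewrite -!EFinB -!EFinD => -[?]; congr EFin; lra.
rewrite !Rintegral_measure_add//; first lra.
all: by [exact: moo|exact: addoo].
Qed.

(** The Jordan decomposition of a difference is not the difference of the Jordan
decompositions, but both represent the same charge, and the integral of a
bounded Lipschitz function depends only on the charge. *)
Lemma pairing_msub mu nu f : BL f ->
  pairing (msub mu nu) f = pairing mu f - pairing nu f.
Proof.
move=> Bf; apply: integral_balance => // A mA.
have jordanE (k : signed_measure S) :
    (jordan_pos (hahnP k) A - jordan_neg (hahnP k) A)%E = k A.
  by rewrite [RHS](jordan_decomp (hahnP k) mA) /cadd/= cscaleN1.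
by rewrite [LHS]jordanE; congr (_ - _)%E; rewrite [RHS]jordanE.
Qed.

End pairing.

(** * The bounded Lipschitz norm and its dual *)

Section BL_norms.
Context {R : realType} {S : completeMetricType R}.
Implicit Types (f : S -> R) (mu nu : signed_measure S) (c k : R).

Lemma sup_norm_le c f : 0 <= c -> (forall x, `|f x| <= c) -> sup_norm f <= c.
Proof.
move=> c0 fc; rewrite /sup_norm.
have [->|/set0P A0] := eqVneq [set `|f x| | x in [set: S]] set0.
  by rewrite sup0.
by apply: ge_sup => // _ [x _ <-].
Qed.

Lemma lip_seminorm_le k f : 0 <= k -> lip k f -> lip_seminorm f <= k.
Proof.
move=> k0 fk; rewrite /lip_seminorm; set A := [set _ | _ in _].
have [->|/set0P A0] := eqVneq A set0; first by rewrite sup0.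
apply: ge_sup => // _ [[x y] /= xy <-].
by rewrite ler_pdivrMr ?mdist_gt0.
Qed.

Lemma le_sup_norm f x : BL f -> `|f x| <= sup_norm f.
Proof.
move=> /BLP[c [_ [_ fc _]]]; apply: ub_le_sup; last by exists x.
by exists c => _ [y _ <-].
Qed.

Lemma lip_seminormP f : BL f -> lip (lip_seminorm f) f.
Proof.
move=> /BLP[_ [k [_ _ fk]]] x y.
have [->|xy] := eqVneq x y; first by rewrite subrr normr0 mdistxx mulr0.
rewrite -ler_pdivrMr ?mdist_gt0//; apply: ub_le_sup; last by exists (x, y).
by exists k => _ [[u v] /= uv <-]; rewrite ler_pdivrMr ?mdist_gt0.
Qed.

Lemma sup_norm_ge0 f : BL f -> 0 <= sup_norm f.
Proof.
move=> Bf; have [[x _]|S0] := pselect (exists x : S, True).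
  exact: le_trans (normr_ge0 _) (le_sup_norm x Bf).
rewrite /sup_norm (_ : [set _ | _ in _] = set0) ?sup0//.
by rewrite -subset0 => y [x _ _]; apply: S0; exists x.
Qed.

Lemma lip_seminorm_ge0 f : BL f -> 0 <= lip_seminorm f.
Proof.
move=> Bf; have [[[x y] xy]|S0] := pselect (exists xy : S * S, xy.1 != xy.2).
  have := lip_seminormP Bf x y => /(le_trans (normr_ge0 _)).
  by rewrite pmulr_lge0// mdist_gt0.
rewrite /lip_seminorm (_ : [set _ | _ in _] = set0) ?sup0//.
by rewrite -subset0 => y [xy xyP _]; apply: S0; exists xy.
Qed.

Lemma BL_unit_ball f : BL f -> BL_norm f <= 1 ->
  (forall x, `|f x| <= 1) /\ lip 1 f.
Proof.
move=> Bf; rewrite /BL_norm => f1.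
have := sup_norm_ge0 Bf; have := lip_seminorm_ge0 Bf => l0 s0.
split=> [x|x y]; first by rewrite (le_trans (le_sup_norm x Bf))//; lra.
by rewrite (le_trans (lip_seminormP Bf x y))// ler_wpM2r ?mdist_ge0//; lra.
Qed.

(** Dividing by [BL_norm f + 1] rather than [BL_norm f] puts [f] in the unit ball
without a case distinction for [f = 0]. *)
Lemma pairing_le_dual_norm mu f : separable S -> BL f ->
  `|pairing mu f| <= (BL_norm f + 1) * BL_dual_norm mu.
Proof.
move=> sepS Bf; have [lin bnd _] := pairing_tight mu sepS.
have s0 := sup_norm_ge0 Bf; have l0 := lip_seminorm_ge0 Bf.
set C := BL_norm f + 1; have C0 : 0 < C by rewrite /C /BL_norm; lra.
have CV : `|C^-1| = C^-1 by rewrite ger0_norm// invr_ge0 ltW.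
pose g x := C^-1 * f x + 0.
have Bg : BL g := BL_lin C^-1 Bf BL0.
have g1 : BL_norm g <= 1.
  apply: (@le_trans _ _ (C^-1 * sup_norm f + C^-1 * lip_seminorm f)).
    rewrite lerD//.
    - apply: sup_norm_le => [|x]; first by rewrite mulr_ge0// invr_ge0 ltW.
      by rewrite /g addr0 normrM CV ler_wpM2l ?invr_ge0 ?(ltW C0)//;
        exact: le_sup_norm.
    - apply: lip_seminorm_le => [|x y]; first by rewrite mulr_ge0// invr_ge0 ltW.
      rewrite /g !addr0 -[X in X * _ * _]CV.
      exact: lipZ (lip_seminormP Bf) x y.
  by rewrite -mulrDr mulrC ler_pdivrMr// mul1r /C /BL_norm lerDl.
have pair0 := tight_functional0 (pairing_tight mu sepS).
have -> : pairing mu f = C * pairing mu g.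
  by rewrite /g lin ?pair0 ?addr0 ?mulVKf ?gt_eqF//; exact: BL0.
rewrite normrM gtr0_norm// ler_wpM2l ?(ltW C0)//.
apply: ub_le_sup; last by exists g.
exists (1 * fine (tv_norm mu)) => _ [h [Bh h1] <-].
by apply: bnd => //; case: (BL_unit_ball Bh h1).
Qed.

(** The Schur property for the functionals [pairing (mu_ n) - pairing mu], whose
tightness comes from that of both terms. *)
Lemma weak_cvg_dual_norm (m e : R) (mu_ : nat -> signed_measure S) mu :
  separable S -> (forall n, fine (tv_norm (mu_ n)) <= m) ->
  (forall f, BL f -> pairing (mu_ n) f @[n --> \oo] --> pairing mu f) ->
  0 < e -> \forall n \near \oo, BL_dual_norm (msub (mu_ n) mu) < e.
Proof.
move=> sepS tvm wcvg e0; pose T := m + fine (tv_norm mu).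
pose L n f := pairing (mu_ n) f - pairing mu f.
have tightL n : tight_functional T (L n).
  apply: tight_functional_le (tight_functionalB (pairing_tight (mu_ n) sepS)
    (pairing_tight mu sepS)).
  by rewrite lerD2r.
have cvgL f : BL f -> L n f @[n --> \oo] --> 0.
  move=> Bf; rewrite -(subrr (pairing mu f)).
  by apply: cvgB; [exact: wcvg|exact: cvg_cst].
have e2 : 0 < e / 2 by rewrite divr_gt0.
have := schur tightL cvgL e2; apply: filterS => n nP.
apply: (@le_lt_trans _ _ (e / 2)); last by lra.
rewrite /BL_dual_norm; set A := [set _ | _ in _].
have [->|/set0P A0] := eqVneq A set0; first by rewrite sup0 ltW.
apply: ge_sup => // _ [f [Bf f1] <-].
have [fb fl] := BL_unit_ball Bf f1.
by rewrite pairing_msub//; exact: nP.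
Qed.

End BL_norms.

(** * The two topologies *)

Section topologies.
Context {R : realType} {S : completeMetricType R}.
Implicit Types (f : S -> R) (mu nu : signed_measure S).

Lemma pairing_preimage_norm_open f (O : set R) : separable S -> BL f ->
  open O -> norm_open [set mu : signed_measure S | O (pairing mu f)].
Proof.
move=> sepS Bf oO mu /= Omu.
have /nbhs_ballP[e /= e0 eO] : nbhs (pairing mu f) O by exact: open_nbhs_nbhs.
have C0 : 0 < BL_norm f + 1.
  by rewrite ltr_wpDl// addr_ge0// ?sup_norm_ge0// lip_seminorm_ge0.
exists (e / (BL_norm f + 1)); first by rewrite divr_gt0.
move=> nu; rewrite ltr_pdivlMr// mulrC => nue; apply: eO.
rewrite /ball/= distrC -pairing_msub//.
exact: le_lt_trans (pairing_le_dual_norm _ sepS Bf) nue.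
Qed.

(** The weak topology is initial for the pairings, so it is enough that these be
continuous for the dual norm. *)
Lemma weak_open_norm_open (W : set (weak_measures S)) : separable S ->
  open W -> norm_open (W : set (normed_measures S)).
Proof.
move=> sepS oW; suff : open (W : set (normed_measures S)) by [].
rewrite openE => mu Wmu.
have cvg_weak : nbhs (mu : normed_measures S) --> (mu : weak_measures S).
  apply/cvg_sup => -[f Bf] A; rewrite nbhsE => -[B [[V oV <-] Vmu] BA].
  apply: (filterS BA); apply: open_nbhs_nbhs; split=> //.
  exact: pairing_preimage_norm_open (set_mem Bf) oV.
by apply: cvg_weak; exact: open_nbhs_nbhs.
Qed.

Lemma pairing_weak_continuous (M : set (signed_measure S)) f : BL f ->
  continuous (fun u : weak_subspace M => pairing (val u) f).
Proof.
move=> Bf u.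
have val_u : val @ (u : weak_subspace M) --> (val u : weak_measures S).
  exact: (@initial_continuous _ (weak_measures S)).
have pair_u : (fun mu : weak_measures S => pairing mu f) @
    (val u : weak_measures S) --> pairing (val u) f.
  have /cvg_sup/(_ (exist _ f (mem_set Bf))) wu :
    nbhs (val u : weak_measures S) --> (val u : weak_measures S) by [].
  move=> A Au; apply: wu; exact: initial_continuous.
exact: cvg_comp val_u pair_u.
Qed.

End topologies.

(** Finite intersections of a countable neighbourhood base form a decreasing base;
a point outside [U] is picked in each of its members. *)
Lemma first_countable_sequence (T : topologicalType) (x : T) (U : set T) :
  first_countable T -> ~ nbhs x U ->
  exists2 u : nat -> T, u @ \oo --> x & forall n, ~ U (u n).
Proof.
move=> /(_ x)[B [cB Bx xB]] xU.
have [B0|[b]] := pfcard_geP cB.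
  have [V] : filter_from B id setT by apply: xB; exact: filterT.
  by rewrite B0.
pose fix W n := if n is n'.+1 then b n' `&` W n' else setT.
have Wx n : nbhs x (W n).
  elim: n => [|n IH]; first exact: filterT.
  by apply: filterI IH; apply: Bx; exact: funS.
have Wb n i : (i < n)%N -> W n `<=` b i.
  elim: n => // n IH; rewrite ltnS leq_eqVlt => /predU1P[->|/IH Wi] y [] //.
  by move=> _ /Wi.
have /choice[u uW] n : exists y, W n y /\ ~ U y.
  apply: contrapT => H; apply: xU; apply: filterS (Wx n) => y Wy.
  by apply: contrapT => Uy; apply: H; exists y.
exists u => [A /xB[_ /(@surj _ _ _ _ b)[i _ <-] bA]|n]; last by case: (uW n).
exists i.+1 => // n /= iltn; apply: bA; have [Wu _] := uW n.
exact: Wb iltn _ Wu.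
Qed.

Theorem theorem3p4 (R : realType) (S : completeMetricType R)
    (M : set (signed_measure S))
    (separableS : separable S)
    (bounded_tvM : (ereal_sup [set tv_norm mu | mu in M] < +oo)%E)
    (first_countable_weakM : first_countable (weak_subspace M)) :
  (@open (weak_subspace M) : set (set (set_type M))) =
  (@open (norm_subspace M) : set (set (set_type M))).
Proof.
pose m := fine (ereal_sup [set tv_norm mu | mu in M]).
have tvM mu : M mu -> fine (tv_norm mu) <= m.
  move=> Mmu; have fin_tv : tv_norm mu \is a fin_num.
    by rewrite fin_numD !fin_num_measure.
  have le_sup := ereal_sup_ubound (imageP (@tv_norm _ S) Mmu).
  have : ereal_sup [set tv_norm mu | mu in M] \is a fin_num.
    rewrite fin_numE (lt_eqF bounded_tvM) andbT gt_eqF//.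
    by rewrite (lt_le_trans _ le_sup)// ltNye_eq fin_tv.
  by move=> fin_sup; apply: fine_le.
apply/seteqP; split=> U.
  move=> [W oW <-]; exists W => //; exact: weak_open_norm_open.
move=> [V oV VU]; suff : open (U : set (weak_subspace M)) by [].
rewrite openE => u Uu; apply: contrapT.
move=> /(first_countable_sequence first_countable_weakM)[w wu wU].
have [e e0 eV] : exists2 e, 0 < e &
    forall nu, BL_dual_norm (msub nu (val u)) < e -> V nu.
  by apply: oV; move: Uu; rewrite -VU.
have wcvg f : BL f -> pairing (val (w n)) f @[n --> \oo] --> pairing (val u) f.
  by move=> Bf; exact: cvg_comp wu (@pairing_weak_continuous _ _ M f Bf u).
have tvw n : fine (tv_norm (val (w n))) <= m.
  by apply: tvM; exact: set_valP.
have [N _ /(_ N (leqnn N)) wN] := weak_cvg_dual_norm separableS tvw wcvg e0.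
by apply: (wU N); rewrite -VU; exact: eV.
Qed.
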